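(* Let $S_A=V(A_h,\ qs-r^2)\subset\mathbb{C}^4$ with $A_h=256-192p+48p^2-4p^3-128q-80pq+p^2q+16q^2+288r+36pr-8qr-108s$ (coordinates $(p,q,r,s)$). The singular locus of the affine algebraic surface $S_A$ is equal to the astroid curve $C_A=V(-12+3p-q,\ r^2-qs,\ 108r+qr-54s,\ 108q+q^2-54r)$.
   Context: $S_A$ is an irreducible affine algebraic surface over $\mathbb{C}$. The curve $C_A$ has the parametrization $C_A=\{(4+3t,\ 9t,\ 3t(6+t/2),\ t(6+t/2)^2):t\in\mathbb{C}\}$. *)

(* Defs.v *)
From mathcomp Require Import all_boot all_order all_algebra.
From mathcomp Require Import boolp classical_sets reals.
From mathcomp Require Import complex mpoly.

Set Implicit Arguments.
Unset Strict Implicit.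
Unset Printing Implicit Defensive.

Import GRing.Theory.
Local Open Scope classical_set_scope.
Local Open Scope ring_scope.

Section AffineVarieties.
Variables (K : closedFieldType) (n : nat).
Implicit Types (V Z : set 'rV[K]_n) (F : set {mpoly K[n]}) (x v : 'rV[K]_n).

Definition eval_at (f : {mpoly K[n]}) x : K := f.@[fun i => x ord0 i].

Definition zero_locus F : set 'rV[K]_n :=
  [set x | forall f, F f -> eval_at f x = 0].

Definition vanishing_ideal V : set {mpoly K[n]} :=
  [set f | forall x, V x -> eval_at f x = 0].

Definition zariski_closed Z : Prop := exists F, Z = zero_locus F.

Definition zariski_irreducible Z : Prop :=
  Z !=set0 /\
  forall Z1 Z2, zariski_closed Z1 -> zariski_closed Z2 ->
    Z `<=` Z1 `|` Z2 -> Z `<=` Z1 \/ Z `<=` Z2.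

(* Strictly increasing chains Y 0 < Y 1 < ... < Y d of irreducible closed
   subsets of V, all of them containing x. They correspond to the chains of
   prime ideals of the local ring of V at x. *)
Definition irreducible_chain V x (d : nat) (Y : nat -> set 'rV[K]_n) : Prop :=
  (forall i, (i <= d)%N ->
     [/\ zariski_closed (Y i), zariski_irreducible (Y i), Y i x & Y i `<=` V]) /\
  (forall i, (i < d)%N -> Y i `<` Y i.+1).

(* d is the dimension of V at x, i.e. the Krull dimension of the local ring
   of V at x. *)
Definition local_dim V x (d : nat) : Prop :=
  (exists Y, irreducible_chain V x d Y) /\
  (forall e Y, irreducible_chain V x e Y -> (e <= d)%N).

(* The Zariski tangent space of V at x, translated to the origin. The equations
   range over the whole vanishing ideal of V, not only over the polynomials by
   which V is presented. *)
Definition tangent_space V x : set 'rV[K]_n :=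
  [set v | forall f, vanishing_ideal V f ->
     \sum_(i < n) eval_at (mderiv i f) x * v ord0 i = 0].

Definition tangent_dim V x (d : nat) : Prop :=
  exists U : {vspace 'rV[K]_n},
    (forall v, v \in U <-> tangent_space V x v) /\ \dim U = d.

Definition regular_point V x : Prop :=
  exists d, local_dim V x d /\ tangent_dim V x d.

Definition singular_locus V : set 'rV[K]_n :=
  [set x | V x /\ ~ regular_point V x].

End AffineVarieties.

Section AstroidSurface.
Variable R : realType.
Local Notation C := R[i].

Definition p_ : {mpoly C[4]} := 'X_(@Ordinal 4 0 isT).
Definition q_ : {mpoly C[4]} := 'X_(@Ordinal 4 1 isT).
Definition r_ : {mpoly C[4]} := 'X_(@Ordinal 4 2 isT).
Definition s_ : {mpoly C[4]} := 'X_(@Ordinal 4 3 isT).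

Definition A_h : {mpoly C[4]} :=
  256 - 192 * p_ + 48 * p_ ^+ 2 - 4 * p_ ^+ 3 - 128 * q_ - 80 * p_ * q_
  + p_ ^+ 2 * q_ + 16 * q_ ^+ 2 + 288 * r_ + 36 * p_ * r_ - 8 * q_ * r_
  - 108 * s_.

Definition S_A : set 'rV[C]_4 :=
  zero_locus [set` [:: A_h; q_ * s_ - r_ ^+ 2]].

Definition astroid_point (t : C) : 'rV[C]_4 :=
  \row_(i < 4) [:: 4 + 3 * t; 9 * t; 3 * t * (6 + t / 2);
                   t * (6 + t / 2) ^+ 2]`_i.

Definition C_A : set 'rV[C]_4 := range astroid_point.

End AstroidSurface.

Arguments p_ {R}.
Arguments q_ {R}.
Arguments r_ {R}.
Arguments s_ {R}.
Arguments A_h {R}.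
Arguments S_A : clear implicits.
Arguments C_A : clear implicits.

(* Main.v *)
Require Import Defs.
From mathcomp Require Import all_boot all_order all_algebra.
From mathcomp Require Import boolp classical_sets reals.
From mathcomp Require Import complex mpoly.
From mathcomp Require Import ring zify.
Import GRing.Theory Num.Theory.
Local Open Scope classical_set_scope.
Local Open Scope ring_scope.

(** The surface is the image of the plane under
    [phi(a,b) = (4 + (a^2 - b^2)/3, a^2, a g, g^2)],
    [g = 2a + (a - b)^2 (a + 2b)/54]: on the cone [qs = r^2], the equation [q A_h = 0]
    is quadratic in [r], with discriminant [64 q (q + 12 - 3p)^3]. The map [phi]
    identifies [(a,b)] with [(-a,-b)] and nothing else, it is an immersion off
    [b = 0], and the line [b = 0] is sent to the astroid curve.

    If [b <> 0], the two defining equations cut the tangent space down to the image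
    of the differential, and [{x} < phi(., b) < S_A] is a chain of length 2. At a
    point with [b = 0], expanding [f(phi(a,b)) = 0] in powers of [b] gives three
    independent tangent vectors. No chain is longer than 2: functions separating
    the members of a chain of length 3 would be algebraically independent on
    [S_A], while any three polynomials in [a, b] are dependent. *)

(** * Polynomial curves, tangent fields and irreducible sets *)

Section PolynomialCurves.
Variables (K : closedFieldType) (n : nat).
Implicit Types (V : set 'rV[K]_n) (f : {mpoly K[n]}) (g w : 'I_n -> {poly K}).

Lemma mpoly_ring_ind (P : {mpoly K[n]} -> Prop) :
  (forall c, P c%:MP) -> (forall i, P 'X_i) ->
  (forall f1 f2, P f1 -> P f2 -> P (f1 + f2)) ->
  (forall f1 f2, P f1 -> P f2 -> P (f1 * f2)) -> forall f, P f.
Proof.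
move=> PC PX PD PM f.
rewrite [f]mpolyE; apply: (big_ind P); [by rewrite -mpolyC0 | exact: PD |].
move=> m _; rewrite -mul_mpolyC; apply: (PM) => //.
rewrite mpolyXE_id; apply: (big_ind P); [by rewrite -mpolyC1 | exact: (PM) |].
move=> i _; elim: (m i) => [|k IH]; first by rewrite expr0 -mpolyC1.
by rewrite exprS; apply: (PM).
Qed.

Definition curve_at g (t : K) : 'rV[K]_n := \row_i (g i).[t].

Definition pullback g f : {poly K} := mmap (@polyC K) g f.

Lemma horner_pullback g f t : (pullback g f).[t] = eval_at f (curve_at g t).
Proof.
rewrite /pullback /eval_at.
elim/mpoly_ring_ind: f => [c|i|f1 f2 IH1 IH2|f1 f2 IH1 IH2].
- by rewrite mmapC mevalC hornerC.
- by rewrite mmapX mmap1U mevalXU mxE.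
- by rewrite mmapD mevalD hornerD IH1 IH2.
- by rewrite rmorphM mevalM hornerM IH1 IH2.
Qed.

Lemma deriv_pullback g f :
  (pullback g f)^`() = \sum_(i < n) pullback g (mderiv i f) * (g i)^`().
Proof.
rewrite /pullback.
elim/mpoly_ring_ind: f => [c|i|f1 f2 IH1 IH2|f1 f2 IH1 IH2].
- rewrite mmapC derivC big1 // => i _; by rewrite mderivC mmap0 mul0r.
- rewrite mmapX mmap1U (bigD1 i) //= big1 => [|j ji].
    rewrite mderivX mnm1E eqxx scale1r.
    have -> : (U_(i) - U_(i) = 0 :> 'X_{1..n})%MM.
      by apply/mnmP => j; rewrite mnmBE subnn mnm0E.
    by rewrite mpolyX0 rmorph1 mul1r addr0.
  by rewrite mderivX mnm1E eq_sym (negbTE ji) scale0r mmap0 mul0r.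
- rewrite mmapD derivD IH1 IH2 -big_split /=; apply: eq_bigr => i _.
  by rewrite mderivD mmapD mulrDl.
- rewrite rmorphM derivM IH1 IH2 mulr_suml mulr_sumr -big_split /=.
  apply: eq_bigr => i _; rewrite mderivM mmapD !rmorphM; ring.
Qed.

Lemma poly_fun_eq0 (p : {poly K}) : (forall t, p.[t] = 0) -> p = 0.
Proof.
move=> p0; apply/eqP/negP => /negP /closed_nonrootP [t /negP]; apply.
by apply/eqP.
Qed.

Definition tangent_pairing f (x v : 'rV[K]_n) : K :=
  \sum_(i < n) eval_at (mderiv i f) x * v ord0 i.

Lemma horner_tangent_pairing g w f t :
  (\sum_(i < n) pullback g (mderiv i f) * w i).[t] =
  tangent_pairing f (curve_at g t) (curve_at w t).
Proof.
rewrite horner_sum; apply: eq_bigr => i _.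
by rewrite hornerM horner_pullback mxE.
Qed.

(** A polynomial vanishing on [V] pulls back along [g] to a univariate polynomial without nonzero
    values, hence to zero over a closed field; the chain rule then gives tangency. *)
Lemma velocity_tangent V g : (forall t, V (curve_at g t)) ->
  forall t, tangent_space V (curve_at g t) (curve_at (fun i => (g i)^`()) t).
Proof.
move=> gV t f fV; rewrite -[LHS]horner_tangent_pairing -deriv_pullback.
suff -> : pullback g f = 0 by rewrite deriv0 horner0.
by apply: poly_fun_eq0 => u; rewrite horner_pullback; apply: fV.
Qed.

(* A nonzero polynomial factor [h] can be cancelled from a tangent field, also
   at the parameters where [h] vanishes. *)
Lemma tangent_field_cancel V g w (h : {poly K}) : h != 0 ->
  (forall t, tangent_space V (curve_at g t) (curve_at (fun i => h * w i) t)) ->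
  forall t, tangent_space V (curve_at g t) (curve_at w t).
Proof.
move=> h0 hw t f fV; rewrite -[LHS]horner_tangent_pairing.
set p := (X in X.[t]); suff -> : p = 0 by rewrite horner0.
apply: (mulfI h0); rewrite mulr0; apply: poly_fun_eq0 => u.
rewrite -[RHS](hw u f fV) -[RHS]horner_tangent_pairing mulr_sumr.
by congr _.[_]; apply: eq_bigr => i _; ring.
Qed.

(** Differentiate the vanishing pairing of the gradient of [f] with [w]: where the derivative falls
    on the gradient, the chain rule produces a factor [g'], which is zero at [t]. *)
Lemma tangent_field_deriv V g w t :
  (forall u, tangent_space V (curve_at g u) (curve_at w u)) ->
  (forall i, (g i)^`().[t] = 0) ->
  tangent_space V (curve_at g t) (curve_at (fun i => (w i)^`()) t).
Proof.
move=> gw g't f fV; rewrite -[LHS]horner_tangent_pairing.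
have p0 : \sum_(i < n) pullback g (mderiv i f) * w i = 0.
  by apply: poly_fun_eq0 => u; rewrite horner_tangent_pairing; apply: gw.
have := congr1 (fun p : {poly K} => p^`().[t]) p0; rewrite /= deriv0 horner0.
rewrite raddf_sum !horner_sum => {2}<-; apply: eq_bigr => i _.
rewrite /= derivM hornerD [X in _ = X + _]hornerM deriv_pullback.
suff -> : (\sum_(j < n) pullback g (mderiv j (mderiv i f)) * (g j)^`()).[t] = 0.
  by rewrite mul0r add0r.
by rewrite horner_sum big1 // => j _; rewrite hornerM g't mulr0.
Qed.

Lemma irreducible_mul_eq0 (Y : set 'rV[K]_n) f1 f2 : zariski_irreducible Y ->
  (forall x, Y x -> eval_at f1 x * eval_at f2 x = 0) ->
  vanishing_ideal Y f1 \/ vanishing_ideal Y f2.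
Proof.
move=> [_ Yirr] f12.
case: (Yirr (zero_locus [set f1]) (zero_locus [set f2])).
- by exists [set f1].
- by exists [set f2].
- move=> x /f12 /eqP; rewrite mulf_eq0 => /orP[] /eqP fx0; [left|right];
  by move=> f ->.
- by move=> sub; left=> x /sub; apply.
- by move=> sub; right=> x /sub; apply.
Qed.

(** If an equation [f1] of the first set fails somewhere on the curve, its pullback is nonzero, so
    every equation [f2] of the second set pulls back to zero: [{poly K}] is a domain. *)
Lemma range_curve_irreducible g : zariski_irreducible (range (curve_at g)).
Proof.
split; first by exists (curve_at g 0); exists 0.
move=> _ _ [F1 ->] [F2 ->] cov.
have [|] := pselect (range (curve_at g) `<=` zero_locus F1); first by left.
move=> /existsNP [x /not_implyP [[t _ <-{x}] /existsNP [f1 /not_implyP [Ff1 f1t]]]].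
right=> _ [u _ <-] f2 Ff2; rewrite -horner_pullback.
suff : pullback g f1 * pullback g f2 = 0.
  move/eqP; rewrite mulf_eq0 => /orP[] /eqP p0; last by rewrite p0 horner0.
  by case: f1t; rewrite -horner_pullback p0 horner0.
apply: poly_fun_eq0 => s; rewrite hornerM !horner_pullback.
have [|xF|xF] := cov (curve_at g s); first by exists s.
- by rewrite (xF f1) // mul0r.
- by rewrite (xF f2) // mulr0.
Qed.

(** Fix [x] in [Y] outside [Z1]: an irreducible [L] joining [x] to [y] cannot lie in [Z1], so it
    lies in [Z2], and [y] with it. *)
Lemma connected_irreducible (Y : set 'rV[K]_n) : Y !=set0 ->
  (forall x y, Y x -> Y y ->
    exists2 L, zariski_irreducible L & [/\ L x, L y & L `<=` Y]) ->
  zariski_irreducible Y.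
Proof.
move=> Y0 conn; split=> // Z1 Z2 cZ1 cZ2 cov.
have [|/existsNP[x /not_implyP [Yx Z1x]]] := pselect (Y `<=` Z1); first by left.
right=> y Yy; have [L [_ Lirr] [Lx Ly LY]] := conn _ _ Yx Yy.
case: (Lirr Z1 Z2 cZ1 cZ2 (subset_trans LY cov)) => LZ; last exact: LZ.
by case: Z1x; apply: LZ.
Qed.

Lemma set1_closed (x : 'rV[K]_n) : zariski_closed [set x].
Proof.
exists [set 'X_i - (x ord0 i)%:MP | i in [set: 'I_n]].
apply/seteqP; split => [_ -> _ [i _ <-]|y y0].
  by rewrite /eval_at mevalB mevalXU mevalC subrr.
apply/rowP => i; apply/eqP; rewrite -subr_eq0; apply/eqP.
rewrite -[RHS](y0 ('X_i - (x ord0 i)%:MP)); last by exists i.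
by rewrite /eval_at mevalB mevalXU mevalC.
Qed.

Lemma set1_irreducible (x : 'rV[K]_n) : zariski_irreducible [set x].
Proof.
split; first by exists x.
by move=> Z1 Z2 _ _ /(_ x erefl) [] xZ; [left|right] => _ ->.
Qed.

End PolynomialCurves.

Arguments curve_at {K n}.
Arguments pullback {K n}.
Arguments tangent_pairing {K n}.

(** * Algebraic dependence of three polynomials in two variables *)

Section AlgebraicDependence.
Variable K : fieldType.

Lemma linear_dependence (I : finType) (m : nat) (v : I -> 'rV[K]_m) :
  (m < #|I|)%N ->
  exists2 c : I -> K, (exists i, c i != 0) & \sum_i c i *: v i = 0.
Proof.
move=> mI; pose A := \matrix_(i < #|I|) v (enum_val i).
have kA : kermx A != 0.
  rewrite -mxrank_eq0 mxrank_ker -lt0n subn_gt0.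
  exact: leq_ltn_trans (rank_leq_col A) mI.
have := kA; rewrite -nz_row_eq0 => /rV0Pn [j cj].
exists (fun i => nz_row (kermx A) ord0 (enum_rank i)).
  by exists (enum_val j); rewrite enum_valK.
have /sub_kermxP := nz_row_sub (kermx A); rewrite mulmx_sum_row => cA.
rewrite -[RHS]cA (reindex (@enum_val I predT)) /=; last first.
  by exists enum_rank => i _; rewrite ?enum_valK ?enum_rankK.
by apply: eq_bigr => i _; rewrite enum_valK rowK.
Qed.

(** [msize] of a nonzero polynomial is its total degree plus one, hence the successors in the
    bounds. *)
Lemma msizeX_leq n (P : {mpoly K[n]}) D i :
  (msize P <= D.+1)%N -> (msize (P ^+ i) <= (i * D).+1)%N.
Proof.
move=> PD; elim: i => [|i IH]; first by rewrite expr0 msize1.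
have [->|P0] := eqVneq P 0; first by rewrite expr0n /= msize0.
rewrite exprS msizeM ?expf_neq0 // mulSn.
by move: (msize P) (msize (P ^+ i)) PD IH => a b; lia.
Qed.

Lemma msizeM_leq n (P Q : {mpoly K[n]}) d e :
  (msize P <= d.+1)%N -> (msize Q <= e.+1)%N -> (msize (P * Q) <= (d + e).+1)%N.
Proof.
have [->|P0] := eqVneq P 0; first by rewrite mul0r msize0.
have [->|Q0] := eqVneq Q 0; first by rewrite mulr0 msize0.
by rewrite msizeM //; move: (msize P) (msize Q) => a b; lia.
Qed.

(* Counting: the [N^3] monomials of exponents below [N] in [P1], [P2], [P3] lie
   in a space of dimension [O(N^2)]. *)
Lemma algebraic_dependence (P1 P2 P3 : {mpoly K[2]}) :
  exists N (c : 'I_N * 'I_N * 'I_N -> K), (exists u, c u != 0) /\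
    \sum_u c u *: (P1 ^+ u.1.1 * P2 ^+ u.1.2 * P3 ^+ u.2) = 0.
Proof.
pose D := (msize P1 + msize P2 + msize P3).+1.
(* All the products have degree below [M]. Since [M < 4 * N * D], the count [M ^ 2] of exponent
   pairs is less than [16 * D ^ 2 * N ^ 2 = N ^ 3]. *)
pose N := (16 * D ^ 2)%N; pose M := (3 * N * D).+1.
pose mon (u : 'I_N * 'I_N * 'I_N) : {mpoly K[2]} :=
  P1 ^+ u.1.1 * P2 ^+ u.1.2 * P3 ^+ u.2.
pose mm (w : 'I_M * 'I_M) : 'X_{1..2} :=
  [multinom nth 0%N [:: w.1 : nat; w.2 : nat] i | i < 2].
pose v u : 'rV[K]_#|{: 'I_M * 'I_M}| := \row_j (mon u)@_(mm (enum_val j)).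
have [|c c0 cv] := @linear_dependence _ _ v.
  rewrite !card_prod !card_ord /M /N.
  have : (0 < D)%N by [].
  nia.
exists N, c; split=> //.
have szmon u : (msize (mon u) <= M)%N.
  have : (msize (mon u) <= (u.1.1 * D + u.1.2 * D + u.2 * D).+1)%N.
    by apply: msizeM_leq; [apply: msizeM_leq|]; apply: msizeX_leq; lia.
  move=> /leq_trans; apply; rewrite /M -!mulnDl ltnS leq_mul2r; apply/orP; right.
  have := ltn_ord u.1.1; have := ltn_ord u.1.2; have := ltn_ord u.2; lia.
apply/mpolyP => m; rewrite mcoeff0.
(* Monomials of degree at least [M] occur in no product; the coefficients of the others are entries
   of the vectors [v u]. *)
have [mM|Mm] := ltnP (mdeg m) M; last first.
  rewrite raddf_sum big1 // => u _; rewrite /= mcoeffZ memN_msupp_eq0 ?mulr0 //.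
  by apply: msize_mdeg_ge; apply: leq_trans (szmon u) Mm.
have [m0 m1] : (m ord0 < M)%N /\ (m ord_max < M)%N.
  move: mM; rewrite mdegE !big_ord_recl big_ord0.
  rewrite (_ : lift ord0 ord0 = ord_max) ?addn0; last exact: val_inj.
  lia.
pose w : 'I_M * 'I_M := (Ordinal m0, Ordinal m1).
have -> : m = mm w.
  apply/mnmP => i; rewrite mnmE; case: i => [[|[|//]] ilt] /=;
  by congr (m _); apply: val_inj.
have := congr1 (fun r : 'rV_#|{: 'I_M * 'I_M}| => r ord0 (enum_rank w)) cv.
rewrite summxE mxE => <-; rewrite raddf_sum; apply: eq_bigr => u _.
by rewrite /= mcoeffZ !mxE enum_rankK.
Qed.

End AlgebraicDependence.

(** * Bounding the length of chains on the image of a plane *)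

Section ChainLength.
Variables (K : closedFieldType) (n : nat).

(* Divide [G] by a power of its variable until the constant term is nonzero, then
   restrict to [Y], where [f] vanishes. *)
Lemma relation_descent (E : nzRingType) (ev : {rmorphism E -> {mpoly K[n]}})
    (Y Y' : set 'rV[K]_n) (f : {mpoly K[n]}) (cf : commr_rmorph ev f) (G : {poly E}) :
  zariski_irreducible Y' -> Y `<=` Y' ->
  vanishing_ideal Y f -> ~ vanishing_ideal Y' f ->
  G != 0 -> vanishing_ideal Y' (horner_morph cf G) ->
  exists2 c, c != 0 & vanishing_ideal Y (ev c).
Proof.
move=> Y'irr YY' fY fY'; elim/poly_ind: G => [|G c IH]; first by rewrite eqxx.
rewrite rmorphD rmorphM /= horner_morphX horner_morphC => G0 evG.
have [c0|c0] := eqVneq c 0; last first.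
  exists c => // x Yx; have := evG x (YY' x Yx).
  by rewrite /eval_at mevalD mevalM [f.@[_]]fY // mulr0 add0r.
apply: IH.
  by apply: contraNneq G0 => ->; rewrite c0 mul0r add0r.
have [|//|//] := @irreducible_mul_eq0 _ _ Y' (horner_morph cf G) f Y'irr.
by move=> x /evG; rewrite c0 rmorph0 addr0 /eval_at mevalM.
Qed.

(** [Y i] is closed, so one of its equations fails at a point of [Y i.+1] outside it. *)
Lemma chain_separating V (x : 'rV[K]_n) d Y i : irreducible_chain V x d Y -> (i < d)%N ->
  exists f, vanishing_ideal (Y i) f /\ ~ vanishing_ideal (Y i.+1) f.
Proof.
move=> [Yd Ylt] id; have [[F YF] _ _ _] := Yd i (ltnW id).
have [_ /existsNP [y /not_implyP [Yy nYy]]] := Ylt i id.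
move: nYy; rewrite YF => /existsNP [f /not_implyP [Ff fy]].
by exists f; split=> [z|fY]; [apply|apply: fy; apply: fY].
Qed.

(** The separating functions, pulled back by [psi], satisfy a nontrivial relation, which therefore
    holds on [Y 3]. Going down the chain eliminates one function at each step, until a nonzero
    constant vanishes on [Y 0]. *)
Lemma irreducible_chain_leq2 V (psi : n.-tuple {mpoly K[2]}) (x : 'rV[K]_n) d Y :
  (forall y, V y -> exists w, y = \row_i (tnth psi i).@[w]) ->
  irreducible_chain V x d Y -> (d <= 2)%N.
Proof.
move=> Vpsi YC; rewrite leqNgt; apply/negP => d3.
have lt i : (i < 3)%N -> (i < d)%N by move=> /leq_trans; apply.
have [f0 [f0Y f0Y']] := chain_separating _ _ _ _ 0 YC (lt 0%N isT).
have [f1 [f1Y f1Y']] := chain_separating _ _ _ _ 1 YC (lt 1%N isT).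
have [f2 [f2Y f2Y']] := chain_separating _ _ _ _ 2 YC (lt 2%N isT).
case: YC => Yd Ylt.
have Yirr i : (i < 4)%N -> zariski_irreducible (Y i).
  by move=> i4; case: (Yd i (leq_trans (i4 : (i <= 3)%N) d3)).
have Ysub i : (i < 3)%N -> Y i `<=` Y i.+1.
  by move=> /lt /Ylt [].
have [N [c [[u0 cu0] crel]]] :=
  @algebraic_dependence K (f0 \mPo psi) (f1 \mPo psi) (f2 \mPo psi).
pose c0 : commr_rmorph (@mpolyC n K) f0 := fun y => mulrC _ _.
pose c1 : commr_rmorph (horner_morph c0) f1 := fun y => mulrC _ _.
pose c2 : commr_rmorph (horner_morph c1) f2 := fun y => mulrC _ _.
(* The relation as an iterated polynomial: the outermost variable stands for [f2], the innermost for
   [f0], in the order in which the descents remove them. *)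
pose G : {poly {poly {poly K}}} :=
  \sum_u (((c u *: 'X^(u.1.1))%:P * 'X^(u.1.2))%:P * 'X^(u.2)).
have G0 : G != 0.
  apply: contraNneq cu0 => /(congr1 (fun p : {poly {poly {poly K}}} =>
    ((p`_u0.2 : {poly {poly K}})`_u0.1.2 : {poly K})`_u0.1.1)).
  rewrite !coef0 !coef_sum (bigD1 u0) //= big1 => [|u uu0];
    rewrite !(coefCM, coefXn, coefZ, mulr_natr, coefMn) ?eqxx ?mulr1n.
    by rewrite addr0 => ->.
  have [e2|] := eqVneq (u0.2 : nat) u.2; last by rewrite /= ?mulr0n ?mul0rn.
  have [e1|] := eqVneq (u0.1.2 : nat) u.1.2; last by rewrite /= ?mulr0n ?mul0rn.
  have [e0|] := eqVneq (u0.1.1 : nat) u.1.1; last by rewrite /= ?mulr0n ?mul0rn.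
  move/eqP: uu0; case; rewrite (surjective_pairing u) (surjective_pairing u.1).
  by rewrite -(val_inj e2) -(val_inj e1) -(val_inj e0) -!surjective_pairing.
have evG : vanishing_ideal (Y 3) (horner_morph c2 G).
  move=> y Yy; have [_ _ _ Y3V] := Yd 3 d3.
  have [w ->] := Vpsi y (Y3V _ Yy).
  have := congr1 (fun p => p.@[w]) crel; rewrite meval0 => <-.
  rewrite !rmorph_sum /eval_at !rmorph_sum; apply: eq_bigr => u _ /=.
  have pull f : f.@[fun i => (\row_i (tnth psi i).@[w]) ord0 i] = (f \mPo psi).@[w].
    by rewrite comp_mpoly_meval; apply: meval_eq => i; rewrite mxE.
  rewrite mevalZ !rmorphM /= !horner_morphC /= horner_morphC -mul_polyC.
  rewrite rmorphM /= horner_morphC !rmorphXn /= !horner_morphX !mevalM mevalC.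
  by rewrite !rmorphXn /= !pull; ring.
have [G1 G10 evG1] :=
  relation_descent _ _ (Y 2) (Y 3) _ _ _ (Yirr 3 isT) (Ysub 2%N isT) f2Y f2Y' G0 evG.
have [G2 G20 evG2] :=
  relation_descent _ _ (Y 1) (Y 2) _ _ _ (Yirr 2 isT) (Ysub 1%N isT) f1Y f1Y' G10 evG1.
have [e e0 eY] :=
  relation_descent _ _ (Y 0) (Y 1) _ _ _ (Yirr 1 isT) (Ysub 0%N isT) f0Y f0Y' G20 evG2.
have [_ _ Y0x _] := Yd 0%N isT.
by move/eqP: e0; apply; have := eY x Y0x; rewrite /eval_at mevalC.
Qed.

End ChainLength.

(** * Tangent vectors and dimension counts *)

Section TangentSpaces.
Variables (K : closedFieldType) (n : nat).
Implicit Types (V : set 'rV[K]_n) (x v u : 'rV[K]_n) (f : {mpoly K[n]}).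

(** The pairing is the derivative of [f] along the line through [x] with direction [v], so for an
    explicit [f] univariate differentiation computes it. *)
Lemma tangent_pairing_line f x v : tangent_pairing f x v =
  (pullback (fun i => (x ord0 i)%:P + (v ord0 i)%:P * 'X) f)^`().[0].
Proof.
rewrite deriv_pullback horner_sum; apply: eq_bigr => i _.
rewrite hornerM horner_pullback derivD derivC add0r deriv_mulC derivX mulr1 hornerC.
congr (eval_at _ _ * _); apply/rowP => j.
by rewrite mxE hornerD hornerM hornerX !hornerC mulr0 addr0.
Qed.

Lemma tangent_dim_geq V x d m (X : m.-tuple 'rV[K]_n) : tangent_dim V x d ->
  free X -> (forall v, v \in X -> tangent_space V x v) -> (m <= d)%N.
Proof.
move=> [U [UT <-]] Xfree XT; rewrite -(size_tuple X) -(eqP Xfree).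
by apply/dimvS/span_subvP => v /XT /UT.
Qed.

Lemma memv_add_lineP v u1 u2 :
  reflect (exists k1 k2, v = k1 *: u1 + k2 *: u2) (v \in <[u1]> + <[u2]>)%VS.
Proof.
apply: (iffP memv_addP) => [[_ /vlineP[k1 ->] [_ /vlineP[k2 ->] ->]]|[k1 [k2 ->]]].
  by exists k1, k2.
by exists (k1 *: u1); [|exists (k2 *: u2)]; rewrite ?memvZ ?memv_line.
Qed.

Lemma dim_add_line u1 u2 :
  (forall k1 k2 : K, k1 *: u1 + k2 *: u2 = 0 -> k1 = 0 /\ k2 = 0) ->
  \dim (<[u1]> + <[u2]>)%VS = 2%N.
Proof.
move=> ind; have /eqP : free [tuple u1; u2].
  apply/freeP => k; rewrite !big_ord_recl big_ord0 addr0 /= => /ind [k1 k2] i.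
  by case: i => [[|[|//]] ilt]; [rewrite -[RHS]k1|rewrite -[RHS]k2];
    congr (k _); apply: val_inj.
by rewrite /= span_cons span_seq1.
Qed.

End TangentSpaces.

(** * The surface and the astroid as images of [phi] *)

Section Parametrization.
Variable R : realType.
Local Notation C := R[i].

Definition i0 : 'I_4 := @Ordinal 4 0 isT.
Definition i1 : 'I_4 := @Ordinal 4 1 isT.
Definition i2 : 'I_4 := @Ordinal 4 2 isT.
Definition i3 : 'I_4 := @Ordinal 4 3 isT.

Lemma forall_ord4 (P : 'I_4 -> Prop) : P i0 -> P i1 -> P i2 -> P i3 -> forall i, P i.
Proof.
move=> P0 P1 P2 P3 [[|[|[|[|//]]]] ilt];
by [rewrite (_ : Ordinal ilt = i0) //; apply: val_inj|
    rewrite (_ : Ordinal ilt = i1) //; apply: val_inj|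
    rewrite (_ : Ordinal ilt = i2) //; apply: val_inj|
    rewrite (_ : Ordinal ilt = i3) //; apply: val_inj].
Qed.

Lemma eval_A_h (x : 'rV[C]_4) : let p := x ord0 i0 in let q := x ord0 i1 in
  let r := x ord0 i2 in let s := x ord0 i3 in
  eval_at A_h x = 256 - 192 * p + 48 * p ^+ 2 - 4 * p ^+ 3 - 128 * q - 80 * p * q
  + p ^+ 2 * q + 16 * q ^+ 2 + 288 * r + 36 * p * r - 8 * q * r - 108 * s.
Proof.
move=> p q r s.
have X (i : 'I_4) : ('X_i : {mpoly C[4]}).@[fun i => x ord0 i] = x ord0 i by exact: mevalXU.
rewrite /p /q /r /s -!X /eval_at /A_h /p_ /q_ /r_ /s_.
ring.
Qed.

Lemma pairing_A_h (x v : 'rV[C]_4) : let p := x ord0 i0 in let q := x ord0 i1 in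
  let r := x ord0 i2 in let s := x ord0 i3 in
  tangent_pairing A_h x v =
    (-192 + 96 * p - 12 * p ^+ 2 - 80 * q + 2 * p * q + 36 * r) * v ord0 i0
    + (-128 - 80 * p + p ^+ 2 + 32 * q - 8 * r) * v ord0 i1
    + (288 + 36 * p - 8 * q) * v ord0 i2 - 108 * v ord0 i3.
Proof.
move=> p q r s; rewrite tangent_pairing_line.
set g := fun i => _.
have X (i : 'I_4) : pullback g 'X_i = g i by rewrite /pullback mmapX mmap1U.
(* Numerals become constant polynomials and powers become products, so that the rules for
   derivatives apply by rewriting. *)
have -> : pullback g A_h = (256%:R)%:P - (192%:R)%:P * g i0
  + (48%:R)%:P * (g i0 * g i0) - (4%:R)%:P * (g i0 * g i0 * g i0)
  - (128%:R)%:P * g i1 - (80%:R)%:P * (g i0 * g i1) + g i0 * g i0 * g i1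
  + (16%:R)%:P * (g i1 * g i1) + (288%:R)%:P * g i2
  + (36%:R)%:P * (g i0 * g i2) - (8%:R)%:P * (g i1 * g i2) - (108%:R)%:P * g i3.
  rewrite -!X /pullback /A_h /p_ /q_ /r_ /s_.
  ring.
have g0 i : (g i).[0] = x ord0 i.
  by rewrite /g hornerD hornerM hornerX !hornerC mulr0 addr0.
have g' i : (g i)^`().[0] = v ord0 i.
  by rewrite /g derivD derivC add0r deriv_mulC derivX mulr1 hornerC.
rewrite !(derivD, derivN, deriv_mulC, derivM, derivC, hornerD, hornerN,
  hornerM, hornerC, g0, g', horner0).
rewrite ?hornerX /p /q /r /s; ring.
Qed.

Lemma eval_cone (x : 'rV[C]_4) :
  eval_at (q_ * s_ - r_ ^+ 2) x = x ord0 i1 * x ord0 i3 - x ord0 i2 ^+ 2.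
Proof.
have X (i : 'I_4) : ('X_i : {mpoly C[4]}).@[fun i => x ord0 i] = x ord0 i.
  exact: mevalXU.
by rewrite -!X /eval_at /q_ /r_ /s_; ring.
Qed.

Lemma pairing_cone (x v : 'rV[C]_4) :
  tangent_pairing (q_ * s_ - r_ ^+ 2) x v =
    x ord0 i3 * v ord0 i1 + x ord0 i1 * v ord0 i3 - 2 * x ord0 i2 * v ord0 i2.
Proof.
rewrite tangent_pairing_line; set g := fun i => _.
have X (i : 'I_4) : pullback g 'X_i = g i by rewrite /pullback mmapX mmap1U.
have -> : pullback g (q_ * s_ - r_ ^+ 2) = g i1 * g i3 - g i2 * g i2.
  by rewrite -!X /pullback /q_ /r_ /s_; ring.
have g0 i : (g i).[0] = x ord0 i.
  by rewrite /g hornerD hornerM hornerX !hornerC mulr0 addr0.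
have g' i : (g i)^`().[0] = v ord0 i.
  by rewrite /g derivD derivC add0r deriv_mulC derivX mulr1 hornerC.
by rewrite derivB !derivM hornerD hornerN !hornerD !hornerM !g0 !g'; ring.
Qed.

Lemma S_AP (x : 'rV[C]_4) :
  S_A R x <-> eval_at A_h x = 0 /\ eval_at (q_ * s_ - r_ ^+ 2) x = 0.
Proof.
split=> [Sx|[A0 c0] f /=]; first by split; apply: Sx; rewrite /= !inE eqxx ?orbT.
by rewrite !inE => /orP[] /eqP ->.
Qed.

(* [c] and [d] stand for [1/3] and [1/54], so that the formulas make sense in
   polynomial rings. *)
Definition astroid_map (A : comNzRingType) (c d a b : A) (i : 'I_4) : A :=
  let g := 2 * a + d * ((a - b) * (a - b) * (a + 2 * b)) in
  [:: 4 + c * (a * a - b * b); a * a; a * g; g * g]`_i.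

Lemma rmorph_astroid_map (A B : comNzRingType) (h : {rmorphism A -> B}) c d a b i :
  h (astroid_map A c d a b i) = astroid_map B (h c) (h d) (h a) (h b) i.
Proof. by elim/forall_ord4: i; rewrite /astroid_map /=; ring. Qed.

Definition phi (a b : C) : 'rV[C]_4 := \row_i astroid_map C 3^-1 54^-1 a b i.

Definition phi_curve (P Q : {poly C}) : 'I_4 -> {poly C} :=
  astroid_map _ (3^-1)%:P (54^-1)%:P P Q.

Lemma curve_at_phi P Q t : curve_at (phi_curve P Q) t = phi P.[t] Q.[t].
Proof.
apply/rowP => i; rewrite !mxE -!horner_evalE rmorph_astroid_map /=.
by rewrite !horner_evalE !hornerC.
Qed.

Lemma S_A_phi a b : S_A R (phi a b).
Proof.
by apply/S_AP; rewrite eval_A_h eval_cone !mxE /astroid_map /=; split; field;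
   rewrite ?pnatr_eq0.
Qed.

(** The coordinates [p] and [q] determine [a] and [b] up to sign; [r] fixes the relative sign, and
    [s] follows from the cone or, when [a = 0], from [A_h]. *)
Lemma phi_onto x : S_A R x -> exists a b, x = phi a b.
Proof.
move=> /S_AP [Ax0 cx0].
set p := x ord0 i0; set q := x ord0 i1; set r := x ord0 i2; set s := x ord0 i3.
have A0 := Ax0; rewrite eval_A_h -/p -/q -/r -/s in A0.
have c0 := cx0; rewrite eval_cone -/q -/r -/s in c0.
pose a := sqrtC q; pose b := sqrtC (q + 12 - 3 * p).
have qa : q = a ^+ 2 by rewrite sqrtCK.
have bE : b ^+ 2 = q + 12 - 3 * p by rewrite sqrtCK.
have pE : p = 4 + 3^-1 * (a ^+ 2 - b ^+ 2).
  by rewrite -qa bE; field; rewrite ?pnatr_eq0.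
clearbody a b.
have [a0|a0] := eqVneq a 0.
  have q0 : q = 0 by rewrite qa a0 expr0n.
  have r0 : r = 0.
    by move/eqP: c0; rewrite q0 mul0r sub0r oppr_eq0 sqrf_eq0 => /eqP.
  have sE : s = (54^-1 * (2 * b ^+ 3)) ^+ 2.
    have n108 : 108 != 0 :> C by rewrite pnatr_eq0.
    apply: (mulfI n108); apply/eqP; rewrite -subr_eq0 -oppr_eq0; apply/eqP.
    by rewrite -[RHS]A0 q0 r0 pE a0; field; rewrite ?pnatr_eq0.
  exists 0, b; apply/rowP; apply: forall_ord4; rewrite mxE /astroid_map /=.
  - by rewrite -/p pE a0; ring.
  - by rewrite -/q q0; ring.
  - by rewrite -/r r0; ring.
  - by rewrite -/s sE; ring.
(* [q * A_h + 108 * (q * s - r ^+ 2)] is free of [s] and quadratic in [r]; multiplying by [-432] and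
   completing the square gives [E ^+ 2 - (8 * a * b ^+ 3) ^+ 2]. *)
pose E := 216 * r - a ^+ 2 * (432 + 4 * a ^+ 2 - 12 * b ^+ 2).
have EE : E ^+ 2 = (8 * a * b ^+ 3) ^+ 2.
  apply/eqP; rewrite -subr_eq0; apply/eqP.
  transitivity (- 432 * (q * eval_at A_h x + 108 * eval_at (q_ * s_ - r_ ^+ 2) x)).
    by rewrite eval_A_h eval_cone -/p -/q -/r -/s /E pE qa; field; rewrite ?pnatr_eq0.
  by rewrite Ax0 cx0 !mulr0 addr0 mulr0.
(* So far [b] is known only through [b ^+ 2], so its sign can be chosen to match [E]. *)
have [b' [bb' Eb']] : exists b', b' ^+ 2 = b ^+ 2 /\ E = 8 * a * b' ^+ 3.
  move/eqP: EE; rewrite eqf_sqr => /orP[] /eqP ->; first by exists b.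
  by exists (- b); split; ring.
have rE : r = a * (2 * a + 54^-1 * ((a - b') * (a - b') * (a + 2 * b'))).
  have n216 : 216 != 0 :> C by rewrite pnatr_eq0.
  apply: (mulfI n216); rewrite -[LHS](subrK (a ^+ 2 * (432 + 4 * a ^+ 2 - 12 * b ^+ 2))).
  by rewrite -/E Eb' -bb'; field; rewrite ?pnatr_eq0.
exists a, b'; apply/rowP; apply: forall_ord4; rewrite mxE /astroid_map /=.
- by rewrite -/p pE -bb'; ring.
- by rewrite -/q qa; ring.
- by rewrite -/r rE.
- have q0 : q != 0 by rewrite qa sqrf_eq0.
  apply: (mulfI q0); rewrite -/s; move/eqP: c0; rewrite subr_eq0 => /eqP ->.
  by rewrite rE qa; ring.
Qed.

(** The parameters are related by [9 t = a^2], and every [t] is reached because square roots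
    exist. *)
Lemma C_A_phi x : C_A R x <-> exists a, x = phi a 0.
Proof.
have phi0 a : phi a 0 = astroid_point (a ^+ 2 / 9).
  apply/rowP; apply: forall_ord4; rewrite !mxE /astroid_map /=;
  by field; rewrite ?pnatr_eq0.
split=> [[t _ <-]|[a ->]]; last by exists (a ^+ 2 / 9).
exists (sqrtC (9 * t)); rewrite phi0 sqrtCK; congr astroid_point.
by field; rewrite ?pnatr_eq0.
Qed.
End Parametrization.

(** * Equations of the astroid, and the local dimension where [b] is nonzero *)

Section SingularLocus.
Variable R : realType.
Local Notation C := R[i].
Local Notation phi := (phi R).
Local Notation S_A := (S_A R).

(** The linear equation gives [p], the last one gives [r], and the third one gives [s] in terms of
    [q]; the parameter is then [t = q / 9]. *)
Lemma C_A_equations : C_A R = zero_locus [set` [:: - 12 + 3 * p_ - q_;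
                               r_ ^+ 2 - q_ * s_;
                               108 * r_ + q_ * r_ - 54 * s_;
                               108 * q_ + q_ ^+ 2 - 54 * r_]].
Proof.
have X (x : 'rV[C]_4) (i : 'I_4) :
  ('X_i : {mpoly C[4]}).@[fun i => x ord0 i] = x ord0 i by exact: mevalXU.
have E1 (x : 'rV[C]_4) : eval_at (- 12 + 3 * p_ - q_) x = - 12 + 3 * x ord0 i0 - x ord0 i1.
  by rewrite -!X /eval_at /p_ /q_; ring.
have E2 (x : 'rV[C]_4) :
    eval_at (r_ ^+ 2 - q_ * s_) x = x ord0 i2 ^+ 2 - x ord0 i1 * x ord0 i3.
  by rewrite -!X /eval_at /q_ /r_ /s_; ring.
have E3 (x : 'rV[C]_4) : eval_at (108 * r_ + q_ * r_ - 54 * s_) x =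
    108 * x ord0 i2 + x ord0 i1 * x ord0 i2 - 54 * x ord0 i3.
  by rewrite -!X /eval_at /q_ /r_ /s_; ring.
have E4 (x : 'rV[C]_4) : eval_at (108 * q_ + q_ ^+ 2 - 54 * r_) x =
    108 * x ord0 i1 + x ord0 i1 ^+ 2 - 54 * x ord0 i2.
  by rewrite -!X /eval_at /q_ /r_; ring.
apply/seteqP; split=> [_ [t _ <-] f /=|x x0].
  rewrite !inE => /or4P[] /eqP ->; rewrite ?E1 ?E2 ?E3 ?E4 !mxE /=;
  by field; rewrite ?pnatr_eq0.
have := x0 (- 12 + 3 * p_ - q_); rewrite E1 /= !inE eqxx => /(_ isT) e1.
have := x0 (108 * r_ + q_ * r_ - 54 * s_); rewrite E3 /= !inE eqxx !orbT => /(_ isT) e3.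
have := x0 (108 * q_ + q_ ^+ 2 - 54 * r_); rewrite E4 /= !inE eqxx !orbT => /(_ isT) e4.
have n3 : 3 != 0 :> C by rewrite pnatr_eq0.
have n54 : 54 != 0 :> C by rewrite pnatr_eq0.
have n9 : 9 != 0 :> C by rewrite pnatr_eq0.
have n2 : 2 != 0 :> C by rewrite pnatr_eq0.
have rE : x ord0 i2 = (108 * x ord0 i1 + x ord0 i1 ^+ 2) / 54.
  apply: (mulfI n54); rewrite mulrCA divff // mulr1; apply/esym/eqP.
  by rewrite -subr_eq0 e4.
have sE : x ord0 i3 = (108 * x ord0 i2 + x ord0 i1 * x ord0 i2) / 54.
  apply: (mulfI n54); rewrite mulrCA divff // mulr1; apply/esym/eqP.
  by rewrite -subr_eq0 e3.
have pE : x ord0 i0 = (12 + x ord0 i1) / 3.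
  apply: (mulfI n3); rewrite mulrCA divff // mulr1; apply/eqP.
  by rewrite -subr_eq0 -[X in _ == X]e1; apply/eqP; ring.
exists (x ord0 i1 / 9) => //; apply/rowP; apply: forall_ord4; rewrite !mxE /=.
- by rewrite pE; field; rewrite ?n3 ?n9.
- by field.
- by rewrite rE; field; rewrite ?n54 ?n9 ?n2.
- by rewrite sE rE; field; rewrite ?n54 ?n9 ?n2.
Qed.

Definition phi_mpoly : 4.-tuple {mpoly C[2]} :=
  [tuple astroid_map {mpoly C[2]} (3^-1)%:MP (54^-1)%:MP 'X_ord0 'X_ord_max i | i < 4].

Lemma phi_meval x : S_A x -> exists w, x = \row_i (tnth phi_mpoly i).@[w].
Proof.
move=> /phi_onto [a [b ->]]; exists (fun i : 'I_2 => if i == ord0 then a else b).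
apply/rowP => i; rewrite !mxE tnth_mktuple rmorph_astroid_map /=.
by rewrite !mevalC !mevalXU.
Qed.

Lemma S_A_chain_leq2 x d Y : irreducible_chain S_A x d Y -> (d <= 2)%N.
Proof. exact: irreducible_chain_leq2 (phi_meval). Qed.

(** Two points of the surface lie on the image under [phi] of the line joining their parameters, an
    irreducible curve. *)
Lemma S_A_irreducible : zariski_irreducible S_A.
Proof.
apply: connected_irreducible; first by exists (phi 0 0); apply: S_A_phi.
move=> _ _ /phi_onto [a [b ->]] /phi_onto [a' [b' ->]].
pose L (u u' : C) : {poly C} := u%:P + (u' - u)%:P * 'X.
have L0 u u' : (L u u').[0] = u by rewrite /L hornerD hornerM hornerX !hornerC; ring.
have L1 u u' : (L u u').[1] = u' by rewrite /L hornerD hornerM hornerX !hornerC; ring.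
exists (range (curve_at (phi_curve R (L a a') (L b b')))).
  exact: range_curve_irreducible.
split.
- by exists 0 => //; rewrite curve_at_phi !L0.
- by exists 1 => //; rewrite curve_at_phi !L1.
- by move=> _ [t _ <-]; rewrite curve_at_phi; apply: S_A_phi.
Qed.

Lemma S_A_closed : zariski_closed S_A. Proof. by eexists. Qed.

Lemma phi_opp a b : phi (- a) (- b) = phi a b.
Proof. by apply/rowP; apply: forall_ord4; rewrite !mxE /astroid_map /=; ring. Qed.

Lemma phi_fiber a b : 12 - 3 * phi a b ord0 i0 + phi a b ord0 i1 = b ^+ 2.
Proof. by rewrite !mxE /astroid_map /=; field; rewrite ?pnatr_eq0. Qed.

Definition ruling b := range (fun a => phi a b).

Lemma ruling_irreducible b : zariski_irreducible (ruling b).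
Proof.
have -> : ruling b = range (curve_at (phi_curve R 'X b%:P)).
  by apply: eq_imagel => a _; rewrite curve_at_phi hornerX hornerC.
exact: range_curve_irreducible.
Qed.

(** By [phi_fiber], the equation [12 - 3p + q = b^2] cuts out the curves with parameters [b] and
    [-b], which coincide by [phi_opp]. *)
Lemma ruling_closed b : zariski_closed (ruling b).
Proof.
pose f : {mpoly C[4]} := (12 - b ^+ 2)%:MP - (3%:R)%:MP * 'X_i0 + 'X_i1.
have fE x : eval_at f x = 12 - 3 * x ord0 i0 + x ord0 i1 - b ^+ 2.
  by rewrite /eval_at mevalD mevalB mevalM !mevalC !mevalXU; ring.
exists [set` [:: A_h; q_ * s_ - r_ ^+ 2; f]]; apply/seteqP; split.
  move=> _ [a _ <-] h /=; have /S_AP [Ah ch] := S_A_phi R a b.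
  by rewrite !inE => /or3P[] /eqP -> //; rewrite fE phi_fiber subrr.
move=> x x0; have /phi_onto [a [b' xE]] : S_A x.
  by apply/S_AP; split; apply: x0; rewrite /= !inE eqxx ?orbT.
have : eval_at f x = 0 by apply: x0; rewrite /= !inE eqxx !orbT.
rewrite fE xE phi_fiber => /eqP; rewrite subr_eq0 eqf_sqr => /orP[] /eqP ->.
  by exists a.
by exists (- a) => //; rewrite -phi_opp opprK.
Qed.

Lemma local_dim_phi a b : b != 0 -> local_dim S_A (phi a b) 2.
Proof.
move=> b0; split; last by move=> e Y; apply: S_A_chain_leq2.
exists (fun i => if i is i'.+1 then if i' is _.+1 then S_A else ruling b
                 else [set phi a b]); split.
  move=> [|[|[|//]]] _ /=.
  - split; [exact: set1_closed|exact: set1_irreducible|by []|].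
    by move=> _ ->; apply: S_A_phi.
  - split; [exact: ruling_closed|exact: ruling_irreducible|by exists a|].
    by move=> _ [a' _ <-]; apply: S_A_phi.
  - split; [exact: S_A_closed|exact: S_A_irreducible|exact: S_A_phi|by []].
move=> [|[|//]] _ /=; split.
- by move=> _ ->; exists a.
(* The ruling has a second point: [u] is chosen so that [u^2] differs from [a^2], and the coordinate
   [q] separates the two. *)
- have phi_q u : phi u b ord0 i1 = u * u by rewrite mxE.
  pose u : C := if a == 0 then 1 else 0.
  move=> sub; have : phi u b = phi a b by apply: sub; exists u.
  move=> /(congr1 (fun x : 'rV[C]_4 => x ord0 i1)); rewrite !phi_q /u.
  have [->|a0] := eqVneq a 0; first by move/eqP; rewrite mul0r mulr1 oner_eq0.
  by move/esym/eqP; rewrite mul0r mulf_eq0 (negbTE a0).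
- by move=> _ [a' _ <-]; apply: S_A_phi.
(* The point [phi 0 0] is off the ruling, because [12 - 3p + q] is zero there and [b^2] on the
   ruling. *)
- move=> /(_ (phi 0 0) (S_A_phi R 0 0)) [a' _ /esym ab].
  by have /eqP := phi_fiber 0 0; rewrite ab phi_fiber expr0n sqrf_eq0 (negbTE b0).
Qed.

End SingularLocus.

(** * Tangent spaces of the surface on the edge [b = 0] and off it *)

Section TangentsToS_A.
Variable R : realType.
Local Notation C := R[i].
Local Notation phi := (phi R).
Local Notation phi_curve := (phi_curve R).
Local Notation S_A := (S_A R).

Definition astroid_da (A : comNzRingType) (c d a b : A) (i : 'I_4) : A :=
  let g := 2 * a + d * ((a - b) * (a - b) * (a + 2 * b)) in
  let ga := 2 + 3 * d * ((a - b) * (a + b)) in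
  [:: 2 * c * a; 2 * a; g + a * ga; 2 * g * ga]`_i.

(* The partial derivative of [astroid_map] in [b], divided by [b]. *)
Definition astroid_db (A : comNzRingType) (c d a b : A) (i : 'I_4) : A :=
  let g := 2 * a + d * ((a - b) * (a - b) * (a + 2 * b)) in
  [:: - (2 * c); 0; - (6 * d * (a * (a - b))); - (12 * d * (g * (a - b)))]`_i.

Definition phi_da (a b : C) : 'rV[C]_4 := \row_i astroid_da C 3^-1 54^-1 a b i.
Definition phi_db (a b : C) : 'rV[C]_4 := \row_i astroid_db C 3^-1 54^-1 a b i.

Lemma rmorph_astroid_da (A B : comNzRingType) (h : {rmorphism A -> B}) c d a b i :
  h (astroid_da A c d a b i) = astroid_da B (h c) (h d) (h a) (h b) i.
Proof. by elim/forall_ord4: i; rewrite /astroid_da /=; ring. Qed.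

Lemma rmorph_astroid_db (A B : comNzRingType) (h : {rmorphism A -> B}) c d a b i :
  h (astroid_db A c d a b i) = astroid_db B (h c) (h d) (h a) (h b) i.
Proof. by elim/forall_ord4: i; rewrite /astroid_db /=; ring. Qed.

Lemma deriv_phi_curve (P Q : {poly C}) i : (phi_curve P Q i)^`() =
  P^`() * astroid_da _ (3^-1)%:P (54^-1)%:P P Q i +
  Q^`() * (Q * astroid_db _ (3^-1)%:P (54^-1)%:P P Q i).
Proof.
rewrite /phi_curve /astroid_map /astroid_da /astroid_db.
have e2 : 2 = (2%:R)%:P :> {poly C} by rewrite rmorph_nat.
have e4 : 4 = (4%:R)%:P :> {poly C} by rewrite rmorph_nat.
move: (_%:P) (54^-1)%:P (derivC (3^-1 : C)) (derivC (54^-1 : C)) => c d c' d'.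
elim/forall_ord4: i => /=; rewrite ?e2 ?e4 !(derivD, derivN, derivM, derivC, c', d');
rewrite ?rmorph_nat; ring.
Qed.

Lemma curve_at_da P Q t :
  curve_at (astroid_da _ (3^-1)%:P (54^-1)%:P P Q) t = phi_da P.[t] Q.[t].
Proof.
apply/rowP => i; rewrite !mxE -!horner_evalE rmorph_astroid_da /=.
by rewrite !horner_evalE !hornerC.
Qed.

Lemma curve_at_db P Q t :
  curve_at (astroid_db _ (3^-1)%:P (54^-1)%:P P Q) t = phi_db P.[t] Q.[t].
Proof.
apply/rowP => i; rewrite !mxE -!horner_evalE rmorph_astroid_db /=.
by rewrite !horner_evalE !hornerC.
Qed.

Lemma S_A_curve P Q t : S_A (curve_at (phi_curve P Q) t).
Proof. by rewrite curve_at_phi; apply: S_A_phi. Qed.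

Lemma eq_curve_at (g1 g2 : 'I_4 -> {poly C}) t : g1 =1 g2 ->
  curve_at g1 t = curve_at g2 t.
Proof. by move=> g12; apply/rowP => i; rewrite !mxE g12. Qed.

Lemma tangent_da a b : tangent_space S_A (phi a b) (phi_da a b).
Proof.
have := velocity_tangent C 4 S_A (phi_curve 'X b%:P) (S_A_curve _ _) a.
rewrite curve_at_phi hornerX hornerC (eq_curve_at _ _ _ (deriv_phi_curve _ _)).
rewrite (_ : curve_at _ _ = phi_da a b) //.
rewrite -[X in phi_da X]hornerX -[X in phi_da _ X](hornerC _ a) -curve_at_da.
by apply: eq_curve_at => i; rewrite derivX derivC mul1r mul0r addr0.
Qed.

(** The velocity in [b] is [b] times this field; cancelling that factor keeps tangency at
    [b = 0]. *)
Lemma tangent_field_db a t : tangent_space S_A (curve_at (phi_curve a%:P 'X) t)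
  (curve_at (astroid_db _ (3^-1)%:P (54^-1)%:P a%:P 'X) t).
Proof.
move: t; apply: (@tangent_field_cancel _ _ _ _ _ 'X); first by rewrite polyX_eq0.
move=> t; have := velocity_tangent C 4 S_A _ (S_A_curve a%:P 'X) t.
congr (tangent_space _ _ _); apply: eq_curve_at => i.
by rewrite deriv_phi_curve derivC derivX mul0r add0r mul1r.
Qed.

Lemma tangent_db a b : tangent_space S_A (phi a b) (phi_db a b).
Proof.
by have := tangent_field_db a b; rewrite curve_at_phi curve_at_db hornerX hornerC.
Qed.

(* Along [b = 0] the map has a cuspidal edge: [phi_db] has a nonzero derivative in
   [b] which is divisible by [a], and [phi_da] is divisible by [a]. *)
Definition cusp_edge : 'I_4 -> {poly C} := fun i =>
  [:: 0; 0; (6 / 54)%:P; (12 / 54)%:P * (2%:R%:P + (54^-1)%:P * ('X * 'X))]`_i.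

Definition cusp_curve : 'I_4 -> {poly C} := fun i =>
  [:: (2 / 3)%:P; 2%:R%:P; 4%:R%:P + (4 / 54)%:P * ('X * 'X);
   2%:R%:P * ((2%:R%:P + (54^-1)%:P * ('X * 'X)) * (2%:R%:P + (3 / 54)%:P * ('X * 'X)))]`_i.

(** The velocity in [b] vanishes at [b = 0], so the field [phi_db] may be differentiated there; the
    result is [a] times [cusp_edge], and cancelling [a] includes the point [a = 0]. *)
Lemma tangent_cusp_edge a : tangent_space S_A (phi a 0) (curve_at cusp_edge a).
Proof.
have phiE t : curve_at (phi_curve 'X 0) t = phi t 0.
  by rewrite curve_at_phi hornerX horner0.
rewrite -phiE; move: a; apply: (@tangent_field_cancel _ _ _ _ _ 'X).
  by rewrite polyX_eq0.
move=> a; have := tangent_field_deriv C 4 S_A (phi_curve a%:P 'X) _ 0 (tangent_field_db a).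
rewrite phiE curve_at_phi hornerX hornerC.
rewrite (_ : curve_at (fun i => (astroid_db _ _ _ _ _ i)^`()) 0 =
             curve_at (fun i => 'X * cusp_edge i) a).
  apply=> i; rewrite deriv_phi_curve derivC derivX mul0r add0r mul1r.
  by rewrite hornerM hornerX mul0r.
apply/rowP => i; rewrite !mxE /astroid_db /cusp_edge.
have e2 : 2 = (2%:R)%:P :> {poly C} by rewrite rmorph_nat.
have e6 : 6 = (6%:R)%:P :> {poly C} by rewrite rmorph_nat.
have e12 : 12 = (12%:R)%:P :> {poly C} by rewrite rmorph_nat.
elim/forall_ord4: i => /=; rewrite ?e2 ?e6 ?e12;
rewrite !(derivD, derivN, derivM, derivX, derivC, deriv0);
rewrite !(hornerD, hornerN, hornerM, hornerX, hornerC); ring.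
Qed.

Lemma tangent_cusp_curve a : tangent_space S_A (phi a 0) (curve_at cusp_curve a).
Proof.
have phiE t : curve_at (phi_curve 'X 0) t = phi t 0.
  by rewrite curve_at_phi hornerX horner0.
rewrite -phiE; move: a; apply: (@tangent_field_cancel _ _ _ _ _ 'X).
  by rewrite polyX_eq0.
move=> a; rewrite phiE; have := tangent_da a 0.
congr (tangent_space _ _ _); apply/rowP => i; rewrite !mxE /astroid_da /cusp_curve.
elim/forall_ord4: i => /=; rewrite !(hornerD, hornerN, hornerM, hornerX, hornerC); ring.
Qed.

Lemma tangent_dim_cusp a d : tangent_dim S_A (phi a 0) d -> (3 <= d)%N.
Proof.
move=> td; apply: (tangent_dim_geq _ _ _ _ _ _
  [tuple phi_db a 0; curve_at cusp_edge a; curve_at cusp_curve a] td).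
  apply/freeP => k; rewrite !big_ord_recl big_ord0 addr0 /=.
  (* The system is triangular: [q] occurs only in [cusp_curve], then [p] only in [phi_db], and [r]
     is a nonzero constant in [cusp_edge]. *)
  have n (m : nat) : (m.+1%:R : C) != 0 by rewrite pnatr_eq0.
  move=> /rowP k0; have := k0 i0; have := k0 i1; have := k0 i2.
  rewrite !mxE /astroid_db /cusp_edge /cusp_curve /= !(hornerC, horner0) => e2 e1 e0.
  have x2 : k (lift ord0 (lift ord0 ord0)) = 0.
    apply: (mulfI (n 1%N)); transitivity (0 : C); last by rewrite mulr0.
    by rewrite -e1; ring.
  have x0 : k ord0 = 0.
    apply: (mulfI (n 1%N)); transitivity (- 3 * 0 : C); last by ring.
    by rewrite -e0 x2; field; rewrite ?n.
  have x1 : k (lift ord0 ord0) = 0.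
    apply: (mulfI (n 1%N)); transitivity (18 * 0 : C); last by ring.
    by rewrite -e2 x2 x0; field; rewrite ?n.
  by case=> [[|[|[|//]]] ilt]; [rewrite -[RHS]x0|rewrite -[RHS]x1|rewrite -[RHS]x2];
    congr (k _); apply: val_inj.
move=> v; rewrite !inE => /or3P[] /eqP ->.
- exact: tangent_db.
- exact: tangent_cusp_edge.
- exact: tangent_cusp_curve.
Qed.

Lemma tangent_space_lin (V : set 'rV[C]_4) x k u v : tangent_space V x u ->
  tangent_space V x v -> tangent_space V x (k *: u + v).
Proof.
move=> uT vT f fV.
have E : k * tangent_pairing f x u + tangent_pairing f x v = 0.
  by rewrite [tangent_pairing _ _ u]uT // [tangent_pairing _ _ v]vT // mulr0 addr0.
rewrite -[RHS]E /tangent_pairing mulr_sumr -big_split; apply: eq_bigr => i _ /=.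
by rewrite !mxE; ring.
Qed.

(** These are the linearized equations of the cone and of [A_h], the latter restricted to vectors
    whose first coordinates vanish. *)
Lemma tangent_S_A a b v : tangent_space S_A (phi a b) v ->
  let g := 2 * a + 54^-1 * ((a - b) * (a - b) * (a + 2 * b)) in
  [/\ g * g * v ord0 i1 + a * a * v ord0 i3 = 2 * (a * g) * v ord0 i2,
      v ord0 i0 = 0 -> v ord0 i1 = 0 ->
        (432 + 4 * a ^+ 2 - 12 * b ^+ 2) * v ord0 i2 = 108 * v ord0 i3 &
      v ord0 i0 = 0 -> v ord0 i1 = 0 -> v ord0 i2 = 0 -> v ord0 i3 = 0].
Proof.
move=> vT g.
have A0 : tangent_pairing A_h (phi a b) v = 0.
  by apply: vT => x /S_AP [].
have c0 : tangent_pairing (q_ * s_ - r_ ^+ 2) (phi a b) v = 0.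
  by apply: vT => x /S_AP [].
rewrite pairing_A_h in A0; rewrite pairing_cone in c0.
have n108 : 108 != 0 :> C by rewrite pnatr_eq0.
split.
- apply/eqP; rewrite -subr_eq0 -[X in _ == X]c0 !mxE /astroid_map /= -/g; apply/eqP; ring.
- move=> v0 v1; apply/eqP; rewrite -subr_eq0 -[X in _ == X]A0 v0 v1 !mxE /astroid_map /=.
  by apply/eqP; field; rewrite ?pnatr_eq0.
- move=> v0 v1 v2; apply: (mulfI n108); rewrite mulr0 -[LHS]opprK -[RHS]oppr0 -[in RHS]A0.
  by rewrite v0 v1 v2; ring.
Qed.

(** Subtracting a combination of [phi_da] and [phi_db] kills two coordinates of a tangent vector;
    the two linearized equations then kill the rest. *)
Lemma tangent_dim_immersed a b : b != 0 -> tangent_dim S_A (phi a b) 2.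
Proof.
move=> b0.
have n (m : nat) : (m.+1%:R : C) != 0 by rewrite pnatr_eq0.
pose g := 2 * a + 54^-1 * ((a - b) * (a - b) * (a + 2 * b)) : C.
have g0 : a = 0 -> g != 0.
  move=> a0; rewrite (_ : g = b ^+ 3 / 27).
    by rewrite mulf_neq0 ?expf_neq0 ?invr_eq0.
  by rewrite /g a0; field; rewrite ?n.
have phi_ind k1 k2 : k1 *: phi_da a b + k2 *: phi_db a b = 0 -> k1 = 0 /\ k2 = 0.
  move=> /rowP k0; have := k0 i0; have := k0 i1; have := k0 i2.
  rewrite !mxE /astroid_da /astroid_db /= -/g => e2 e1 e0.
  have k2E : k2 = k1 * a.
    apply: (mulfI (n 1%N)); apply/eqP; rewrite -subr_eq0 -oppr_eq0; apply/eqP.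
    transitivity (3 * 0 : C); last by rewrite mulr0.
    by rewrite -e0; field; rewrite ?n.
  have [a0|a0] := eqVneq a 0.
    move/eqP: e2; rewrite k2E a0 !(mul0r, mulr0, addr0, oppr0) mulf_eq0.
    by rewrite (negbTE (g0 a0)) orbF => /eqP.
  move/eqP: e1; rewrite mulr0 addr0 !mulf_eq0 (negbTE a0) (negbTE (n 1%N)) !orbF.
  by rewrite k2E => /eqP ->; rewrite mul0r.
exists (<[phi_da a b]> + <[phi_db a b]>)%VS; split; last exact: dim_add_line.
move=> v; split=> [/memv_add_lineP [k1 [k2 ->]]|vT].
  rewrite -[k2 *: _]addr0; apply: tangent_space_lin; first exact: tangent_da.
  apply: tangent_space_lin; first exact: tangent_db.
  by move=> f _; rewrite big1 // => i _; rewrite mxE mulr0.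
apply/memv_add_lineP.
(* For nonzero [a] these solve for the coordinates [p] and [q]. At [a = 0] the vector [phi_da] has
   zero [p] and [q] entries, and its [r] entry [g] is used instead. *)
pose k2 := if a == 0 then - (3 / 2) * v ord0 i0 else v ord0 i1 / 2 - 3 / 2 * v ord0 i0.
pose k1 := if a == 0 then v ord0 i2 / g else v ord0 i1 / (2 * a).
exists k1, k2; apply/eqP; rewrite -subr_eq0 opprD addrA; apply/eqP.
set u := _ - _.
have uE : u = (- k1) *: phi_da a b + ((- k2) *: phi_db a b + v).
  by rewrite /u !scaleNr [RHS]addrCA (addrC _ v) [LHS]addrC.
have uT : tangent_space S_A (phi a b) u.
  rewrite uE; apply: tangent_space_lin; first exact: tangent_da.
  by apply: tangent_space_lin; first exact: tangent_db.
have [] := tangent_S_A _ _ _ uT; rewrite -/g => uc uA uA'.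
have ui i : u ord0 i = - k1 * phi_da a b ord0 i + (- k2 * phi_db a b ord0 i + v ord0 i).
  by rewrite uE !mxE.
suff [u0 u1 u2 u3] : [/\ u ord0 i0 = 0, u ord0 i1 = 0, u ord0 i2 = 0 & u ord0 i3 = 0].
  by apply/rowP; apply: forall_ord4; rewrite [RHS]mxE.
have [a0|a0] := eqVneq a 0.
  have u0 : u ord0 i0 = 0.
    rewrite ui !mxE /astroid_da /astroid_db /= /k2 a0 eqxx.
    by field; rewrite ?n.
  have u2 : u ord0 i2 = 0.
    rewrite ui !mxE /astroid_da /astroid_db /= -/g /k1 a0 eqxx.
    rewrite !(mul0r, mulr0, addr0, oppr0, add0r) mulNr mulfVK ?g0 //.
    by rewrite addNr.
  have u1 : u ord0 i1 = 0.
    move/eqP: uc; rewrite a0 !(mul0r, mulr0, addr0) !mulf_eq0 (negbTE (g0 a0)).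
    by move/eqP.
  by split=> //; apply: uA'.
have u0 : u ord0 i0 = 0.
  rewrite ui !mxE /astroid_da /astroid_db /= /k1 /k2 (negbTE a0).
  by field; rewrite ?n ?a0.
have u1 : u ord0 i1 = 0.
  rewrite ui !mxE /astroid_da /astroid_db /= /k1 /k2 (negbTE a0).
  by field; rewrite ?n ?a0.
have uAr := uA u0 u1.
have u3E : a * u ord0 i3 = 2 * g * u ord0 i2.
  apply: (mulfI a0); transitivity (g * g * u ord0 i1 + a * a * u ord0 i3).
    by rewrite u1; ring.
  by rewrite uc; ring.
have u2 : u ord0 i2 = 0.
  (* Up to a factor [a], this is the determinant of the two linearized equations in the remaining
     coordinates [r] and [s]; it vanishes exactly on the edge. *)
  have nz : - 8 * b ^+ 3 != 0 by rewrite mulf_neq0 ?oppr_eq0 ?(n 7%N) // expf_neq0.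
  apply: (mulfI nz); rewrite mulr0.
  transitivity (a * ((432 + 4 * a ^+ 2 - 12 * b ^+ 2) * u ord0 i2)
                - 108 * (2 * g * u ord0 i2)).
    by rewrite /g; field; rewrite ?n.
  by rewrite uAr -u3E; ring.
split=> //; move/eqP: u3E; rewrite u2 mulr0 mulf_eq0 (negbTE a0).
by move/eqP.
Qed.
End TangentsToS_A.

(** * The singular locus *)

Theorem proposition4p27 (R : realType) :
  singular_locus (S_A R) = C_A R /\
  C_A R = zero_locus [set` [:: - 12 + 3 * p_ - q_;
                               r_ ^+ 2 - q_ * s_;
                               108 * r_ + q_ * r_ - 54 * s_;
                               108 * q_ + q_ ^+ 2 - 54 * r_]].
Proof.
split; last exact: C_A_equations.
apply/seteqP; split=> [x [/phi_onto [a [b ->]] sing]|x /C_A_phi [a ->]].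
  have [->|b0] := eqVneq b 0; first by apply/C_A_phi; exists a.
  case: sing; exists 2%N; split; first exact: local_dim_phi.
  exact: tangent_dim_immersed.
split; first exact: S_A_phi.
(* Regularity would give a chain as long as the tangent dimension, which is at least 3 on the
   edge. *)
move=> [d [[[Y Yd] _] /tangent_dim_cusp]].
by rewrite ltnNge (S_A_chain_leq2 _ _ _ _ Yd).
Qed.
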